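(* Let $\Bbbk$ be a field, let $\mathcal A=\{H_1,\dots,H_n\}$ be a central arrangement of $n$ distinct linear hyperplanes in $\mathbb C^\ell$ with underlying matroid $\mathfrak G$, let $\Gamma\in\mathcal N(\mathfrak G,\Bbbk)$ and $K=K(\Gamma,\Bbbk)$, and assume $\overline V(\Gamma,\Bbbk)$ is nonempty. Suppose $\lambda\in V(\Gamma,\Bbbk)$ with $\lambda\neq 0$, and $\eta\in Z_\Gamma(\lambda,\Bbbk)\setminus\Bbbk\lambda$. Then, for any block $S$ of $\Gamma$, the line $\bar\lambda\ast\bar\eta$ meets $\bar D_S$. Conversely, if $L=\bar\lambda\ast\bar\eta$ is a line in $\bar K$ which meets $\bar D_S$ for every block $S$ of $\Gamma$, then $L\subseteq\overline V(\Gamma,\Bbbk)$.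
   Context: Write $[n]=\{1,\dots,n\}$. The matroid $\mathfrak G$ is the matroid on $[n]$ whose circuits are the minimal sets $C\subseteq[n]$ with $\operatorname{codim}(\bigcap_{i\in C}H_i)<|C|$. A line of $\mathfrak G$ is a rank-two flat, i.e. a set $\{m\in[n]: H_m\supseteq H_i\cap H_j\}$ with $i\ne j$; $\mathcal X(\mathfrak G)$ is the set of lines, and $\mathcal X_0(\mathfrak G)$ is the set of lines $X$ with $|X|\ge3$ (nontrivial lines). For $S\subseteq[n]$ and $\xi\in\Bbbk^n$, $\xi_S=\sum_{i\in S}\xi_i$. Let $\Gamma$ be a (simple) graph with vertex set $[n]$. A clique is a set of pairwise adjacent vertices; a block is a maximal clique. $\Gamma$ is $\mathfrak G$-neighborly if for every $X\in\mathcal X(\mathfrak G)$ and every block $S$ of $\Gamma$, $|X\cap S|\ge|X|-1$ implies $X\subseteq S$. Let $\mathcal X_\Gamma(\mathfrak G)=\{X\in\mathcal X_0(\mathfrak G): X\text{ is not a clique of }\Gamma\}$ and $K(\Gamma,\Bbbk)=\{\xi\in\Bbbk^n:\xi_X=0\text{ for every }X\in\mathcal X_\Gamma(\mathfrak G)\}$. For $\lambda\in K(\Gamma,\Bbbk)$ let $Z_\Gamma(\lambda,\Bbbk)=\{\eta\in K(\Gamma,\Bbbk):\lambda_i\eta_j-\lambda_j\eta_i=0\text{ for every edge }\{i,j\}\text{ of }\Gamma\}$, a linear subspace. $\mathcal N(\mathfrak G,\Bbbk)$ is the set of $\mathfrak G$-neighborly graphs $\Gamma$ with vertex set $[n]$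 and $\dim K(\Gamma,\Bbbk)\ge2$. For $\Gamma\in\mathcal N(\mathfrak G,\Bbbk)$, $V(\Gamma,\Bbbk)=\{\lambda\in K(\Gamma,\Bbbk):\dim_\Bbbk Z_\Gamma(\lambda,\Bbbk)\ge 2\}$. For a $\Bbbk$-vector space $K$, $\bar K=\mathbb P(K)=\{\Bbbk\xi:\xi\in K\setminus\{0\}\}$; for a subspace $D\subseteq K$, $\bar D=\mathbb P(D)\subseteq\bar K$; for $\xi\ne0$, $\bar\xi=\Bbbk\xi\in\bar K$; for distinct points $\bar\xi,\bar\nu$, $\bar\xi\ast\bar\nu$ is the projective line through them. $\overline V(\Gamma,\Bbbk)=\{\bar\lambda:\lambda\in V(\Gamma,\Bbbk)\setminus\{0\}\}$ is the projective image of $V(\Gamma,\Bbbk)$. For a block $S$ of $\Gamma$, $D_S=\{\xi\in K(\Gamma,\Bbbk):\xi_i=0\text{ for all }i\in S\}$. *)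

(* Defs.v *)
From HB Require Import structures.
From mathcomp Require Import all_boot all_order all_algebra.

Set Implicit Arguments.
Unset Strict Implicit.
Unset Printing Implicit Defensive.

Import GRing.Theory.
Local Open Scope ring_scope.

Section Arrangement.
Variables (C : fieldType) (l n : nat) (H : 'I_n -> {vspace 'rV[C]_l}).

(* [l] is forced to be positive as soon as [0 < n]: there is no hyperplane in
   the zero space. *)
Definition central_arrangement : Prop :=
  injective H /\ (forall i, (\dim (H i)).+1 = l).

(* For [i != j], the rank-two flat of the underlying matroid spanned by [i] and
   [j], read off from the hyperplanes. *)
Definition line_through (i j : 'I_n) : {set 'I_n} :=
  [set m | (H i :&: H j <= H m)%VS].

Definition lines : {set {set 'I_n}} :=
  [set X | [exists i, exists j, (i != j) && (X == line_through i j)]].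

Definition nontrivial_lines : {set {set 'I_n}} :=
  [set X in lines | (3 <= #|X|)%N].

End Arrangement.

Record sgraph (n : nat) := SGraph {
  edge :> rel 'I_n;
  edge_sym : symmetric edge;
  edge_irr : irreflexive edge }.

Section Graph.
Variables (n : nat) (Gamma : sgraph n).

Definition clique (S : {set 'I_n}) : bool :=
  [forall i in S, forall j in S, (i != j) ==> Gamma i j].

Definition block (S : {set 'I_n}) : bool := maxset clique S.

End Graph.

Section LinearForms.
Variables (k : fieldType) (n : nat).
Implicit Types (xi lambda eta : 'rV[k]_n).

Definition sum_on (S : {set 'I_n}) xi : k^o := \sum_(i in S) xi 0 i.

Lemma sum_on_is_linear S : linear (sum_on S).
Proof.
move=> a u v; rewrite /sum_on scaler_sumr -big_split /=.
by apply: eq_bigr => i _; rewrite !mxE.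
Qed.
HB.instance Definition _ S :=
  GRing.isLinear.Build k 'rV[k]_n k^o _ (sum_on S) (sum_on_is_linear S).

Definition coord_at (i : 'I_n) xi : k^o := xi 0 i.

Lemma coord_at_is_linear i : linear (coord_at i).
Proof. by move=> a u v; rewrite /coord_at !mxE. Qed.
HB.instance Definition _ i :=
  GRing.isLinear.Build k 'rV[k]_n k^o _ (coord_at i) (coord_at_is_linear i).

Definition minor lambda (i j : 'I_n) eta : k^o :=
  lambda 0 i * eta 0 j - lambda 0 j * eta 0 i.

Lemma minor_is_linear lambda i j : linear (minor lambda i j).
Proof.
move=> a u v; rewrite /minor !mxE /= !mulrDr scalerBr /GRing.scale /=.
by rewrite opprD addrACA !(mulrCA _ a).
Qed.
HB.instance Definition _ lambda i j :=
  GRing.isLinear.Build k 'rV[k]_n k^o _ (minor lambda i j)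
    (minor_is_linear lambda i j).

End LinearForms.

Section Resonance.
Variables (k : fieldType) (C : fieldType) (l n : nat).
Variables (H : 'I_n -> {vspace 'rV[C]_l}) (Gamma : sgraph n).
Implicit Types (xi lambda eta : 'rV[k]_n) (S X : {set 'I_n}).

Definition neighborly : Prop :=
  forall X S, X \in lines H -> block Gamma S ->
    (#|X| - 1 <= #|X :&: S|)%N -> X \subset S.

Definition lines_nonclique : {set {set 'I_n}} :=
  [set X in nontrivial_lines H | ~~ clique Gamma X].

Definition Kspace : {vspace 'rV[k]_n} :=
  (\bigcap_(X in lines_nonclique) lker (linfun (@sum_on k n X)))%VS.

Lemma mem_K xi :
  reflect (forall X, X \in lines_nonclique -> \sum_(i in X) xi 0 i = 0)
          (xi \in Kspace).
Proof.
rewrite memvE; apply: (iffP subv_bigcapP) => h X /h;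
  rewrite -memvE memv_ker lfunE => /eqP // -> //.
Qed.

Definition Zspace lambda : {vspace 'rV[k]_n} :=
  (Kspace :&: \bigcap_(e : 'I_n * 'I_n | Gamma e.1 e.2)
            lker (linfun (minor lambda e.1 e.2)))%VS.

Lemma mem_Z lambda eta :
  reflect (eta \in Kspace /\
           (forall i j, Gamma i j ->
              lambda 0 i * eta 0 j - lambda 0 j * eta 0 i = 0))
          (eta \in Zspace lambda).
Proof.
rewrite memv_cap; apply: (iffP andP) => -[-> h]; split=> //.
  move=> i j ij; move: h; rewrite memvE => /subv_bigcapP /(_ (i, j) ij).
  by rewrite -memvE memv_ker lfunE => /eqP.
rewrite memvE; apply/subv_bigcapP => -[i j] /= ij.
by rewrite -memvE memv_ker lfunE; apply/eqP/h.
Qed.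

Definition Dspace S : {vspace 'rV[k]_n} :=
  (Kspace :&: \bigcap_(i in S) lker (linfun (@coord_at k n i)))%VS.

Lemma mem_D S xi :
  reflect (xi \in Kspace /\ (forall i, i \in S -> xi 0 i = 0)) (xi \in Dspace S).
Proof.
rewrite memv_cap; apply: (iffP andP) => -[-> h]; split=> //.
  move=> i iS; move: h; rewrite memvE => /subv_bigcapP /(_ i iS).
  by rewrite -memvE memv_ker lfunE => /eqP.
rewrite memvE; apply/subv_bigcapP => i iS.
by rewrite -memvE memv_ker lfunE; apply/eqP/h.
Qed.

Definition in_N : Prop := neighborly /\ (2 <= \dim Kspace)%N.

End Resonance.

From mathcomp Require Import classical_sets.
Local Open Scope classical_set_scope.

Definition Vset (k C : fieldType) (l n : nat) (H : 'I_n -> {vspace 'rV[C]_l})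
    (Gamma : sgraph n) : set 'rV[k]_n :=
  [set lambda | lambda \in Kspace k H Gamma /\
                (2 <= \dim (Zspace H Gamma lambda))%N].

Arguments Vset k {C l n} H Gamma.

Section Projective.
Variables (k : fieldType) (n : nat).

(* A projective point is the corresponding vector line [<[xi]>%VS]. *)
Definition proj_image (A : set 'rV[k]_n) : set {vspace 'rV[k]_n} :=
  [set <[xi]>%VS | xi in A `\ 0].

Definition proj_space (D : {vspace 'rV[k]_n}) : set {vspace 'rV[k]_n} :=
  proj_image [set xi | xi \in D].

(* The projective line joining two distinct points [p] and [q]. *)
Definition proj_line (p q : {vspace 'rV[k]_n}) : set {vspace 'rV[k]_n} :=
  proj_space (p + q)%VS.

End Projective.

Definition Vbar (k C : fieldType) (l n : nat) (H : 'I_n -> {vspace 'rV[C]_l})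
    (Gamma : sgraph n) : set {vspace 'rV[k]_n} :=
  proj_image (Vset k H Gamma).
Arguments Vbar k {C l n} H Gamma.

(* Main.v *)
(** The vanishing on [i] and [j] of a nontrivial combination of [lambda] and
    [eta] forces [lambda_i eta_j - lambda_j eta_i = 0]; conversely, if all these
    minors vanish on [S] and [lambda_i != 0] for some [i] in [S], then the
    combination [lambda_i eta - eta_i lambda] is nonzero and vanishes on [S].
    Every edge lies in a block, so vanishing on all edges is vanishing on all
    blocks. *)
Require Import Defs.
From mathcomp Require Import all_boot all_order all_algebra.
From mathcomp Require Import classical_sets reals complex.
From mathcomp Require Import ring.

Import GRing.Theory.
Local Open Scope ring_scope.
Local Open Scope classical_set_scope.

(** The two ends form a clique, and by finiteness any clique extends to a maximal one. *)
Lemma edge_in_block (n : nat) (Gamma : sgraph n) (i j : 'I_n) :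
  Gamma i j -> exists S, [/\ block Gamma S, i \in S & j \in S].
Proof.
move=> ij; have cl : clique Gamma (i |: [set j])%SET.
  apply/forall_inP => a; rewrite !inE => /orP[]/eqP->; apply/forall_inP => b;
    by rewrite !inE => /orP[]/eqP->; rewrite ?eqxx // ?ij ?implybT // edge_sym
      ij implybT.
have [S maxS /fintype.subsetP sub] := maxset_exists cl.
by exists S; split; [exact: maxS | |]; apply: sub; rewrite !inE eqxx ?orbT.
Qed.

Lemma mem_add_lines (k : fieldType) (V : vectType k) (u v w : V) :
  reflect (exists a b, w = a *: u + b *: v) (w \in <[u]> + <[v]>)%VS.
Proof.
apply: (iffP memv_addP) => [[_ /vlineP[a ->] [_ /vlineP[b ->] ->]]|[a [b ->]]].
  by exists a, b.
by exists (a *: u); rewrite ?memvZ ?memv_line //;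
  exists (b *: v); rewrite ?memvZ ?memv_line.
Qed.

Lemma dim_add_lines (k : fieldType) (V : vectType k) (u v : V) :
  u != 0 -> v \notin <[u]>%VS -> (2 <= \dim (<[u]> + <[v]>))%N.
Proof.
move=> u0 vNu; have -> : 2%N = (\dim <[u]>).+1 by rewrite dim_vline u0.
(* Equal dimensions would make the sum collapse to [<[u]>], which would then contain [v]. *)
rewrite (ltn_leqif (dimv_leqif_sup (addvSl _ _))).
by apply: contra vNu => /(subv_trans (addvSr _ _)); rewrite -memvE.
Qed.

(** Trades common projective points for common nonzero vectors: generators of the same point are
    proportional, so either of them lies in both subspaces. *)
Lemma proj_spaceI_neq0 (k : fieldType) (n : nat) (D E : {vspace 'rV[k]_n}) :
  proj_space D `&` proj_space E !=set0 <->
  exists v, [/\ v != 0, v \in D & v \in E].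
Proof.
split=> [[_ [[v [/= vD v0] <-] [w [/= wE _] vw]]]|[v [v0 vD vE]]].
  exists v; split=> //; first exact/eqP.
  by move: (memv_line v); rewrite -vw => /vlineP[c ->]; apply: memvZ.
by exists <[v]>%VS; split; exists v; split=> //; apply/eqP.
Qed.

(** A square matrix with a nonzero kernel vector [(a, b)] is singular: by Cramer's identities, both
    [a] and [b] annihilate the determinant. *)
Lemma minor_eq0 (k : fieldType) (a b x1 x2 y1 y2 : k) :
  (a != 0) || (b != 0) ->
  a * x1 + b * y1 = 0 -> a * x2 + b * y2 = 0 -> x1 * y2 - x2 * y1 = 0.
Proof.
move=> ab0 e1 e2.
have ea : a * (x1 * y2 - x2 * y1) = 0.
  have -> : a * (x1 * y2 - x2 * y1) =
    (a * x1 + b * y1) * y2 - (a * x2 + b * y2) * y1 by ring.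
  by rewrite e1 e2 !mul0r subrr.
have eb : b * (x1 * y2 - x2 * y1) = 0.
  have -> : b * (x1 * y2 - x2 * y1) =
    (a * x2 + b * y2) * x1 - (a * x1 + b * y1) * x2 by ring.
  by rewrite e1 e2 !mul0r subrr.
case/orP: ab0 => c0; apply/eqP.
  by move/eqP: ea; rewrite mulf_eq0 (negPf c0).
by move/eqP: eb; rewrite mulf_eq0 (negPf c0).
Qed.

Section Resonance.
Context {k C : fieldType} {l n : nat}.
Variables (H : 'I_n -> {vspace 'rV[C]_l}) (Gamma : sgraph n).
Implicit Types (lambda eta xi : 'rV[k]_n).

Lemma Z_line_meets_D lambda eta (S : {set 'I_n}) :
  lambda \in Kspace k H Gamma -> lambda != 0 ->
  eta \in Zspace H Gamma lambda -> eta \notin <[lambda]>%VS ->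
  clique Gamma S ->
  exists v, [/\ v != 0, v \in (<[lambda]> + <[eta]>)%VS & v \in Dspace k H Gamma S].
Proof.
move=> lK l0 /mem_Z[eK edge0] eNl /forall_inP clS.
(* If [lambda] vanishes on [S], it is itself the required vector. *)
have [/forall_inP lS0|/forall_inPn[i iS li0]] :=
    boolP [forall i in S, lambda 0 i == 0].
  exists lambda; split=> //; first exact: subvP (addvSl _ _) _ (memv_line _).
  by apply/mem_D; split=> // i /lS0 /eqP.
(* Coordinate [j] of this vector is the minor of [lambda] and [eta] at [i], [j]. *)
exists (- eta 0 i *: lambda + lambda 0 i *: eta); split.
(* Were it zero, dividing by [lambda 0 i] would make [eta] a multiple of [lambda]. *)
- apply: contra eNl; rewrite scaleNr addrC subr_eq0 => /eqP e.
  by rewrite -[eta](scalerK li0) e !memvZ ?memv_line.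
- by apply/mem_add_lines; eexists; eexists.
apply/mem_D; split=> [|j jS]; first by rewrite memvD ?memvZ.
rewrite !mxE; have [->|ij] := eqVneq i j; first by ring.
move/forall_inP: (clS i iS) => /(_ j jS) /implyP /(_ ij) /edge0 e.
by rewrite -[RHS]e; ring.
Qed.

Lemma block_meets_edge_minor lambda eta (i j : 'I_n) :
  (forall S, block Gamma S -> exists v,
     [/\ v != 0, v \in (<[lambda]> + <[eta]>)%VS & v \in Dspace k H Gamma S]) ->
  Gamma i j -> lambda 0 i * eta 0 j - lambda 0 j * eta 0 i = 0.
Proof.
move=> meets /edge_in_block[S [blS iS jS]].
have [v [v0 /mem_add_lines[a [b ev]] /mem_D[_ vS]]] := meets S blS.
rewrite {v}ev in v0 vS.
(* Both coefficients zero would give [v = 0]. *)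
have ab0 : (a != 0) || (b != 0).
  rewrite -negb_and; apply: contra v0 => /andP[/eqP-> /eqP->].
  by rewrite !scale0r addr0.
by apply: (minor_eq0 _ _ _ _ _ _ _ ab0); [move: (vS i iS) | move: (vS j jS)]; rewrite !mxE.
Qed.

(* The minors of two vectors of the plane are multiples of those of
   [lambda] and [eta]. *)
Lemma line_sub_Z lambda eta xi :
  lambda \in Kspace k H Gamma -> eta \in Kspace k H Gamma ->
  (forall i j, Gamma i j -> lambda 0 i * eta 0 j - lambda 0 j * eta 0 i = 0) ->
  xi \in (<[lambda]> + <[eta]>)%VS ->
  (<[lambda]> + <[eta]> <= Zspace H Gamma xi)%VS.
Proof.
move=> lK eK edge0 /mem_add_lines[a [b ->]]; apply/subvP => zeta.
move=> /mem_add_lines[c [d ->{zeta}]]; apply/mem_Z.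
split=> [|i j /edge0 e]; first by rewrite memvD ?memvZ.
(* The factor is the determinant of the coefficients of the two vectors. *)
rewrite !mxE; transitivity
  ((a * d - b * c) * (lambda 0 i * eta 0 j - lambda 0 j * eta 0 i)).
  by ring.
by rewrite e mulr0.
Qed.

End Resonance.

Theorem theorem3p1 (k : fieldType) (R : realType) (l n : nat)
    (H : 'I_n -> {vspace 'rV[R[i]]_l}) (arrH : central_arrangement H)
    (Gamma : sgraph n) (GammaN : in_N k H Gamma)
    (V_neq0 : Vbar k H Gamma !=set0) :
  (forall lambda eta : 'rV[k]_n,
     Vset k H Gamma lambda -> lambda != 0 ->
     eta \in Zspace H Gamma lambda -> eta \notin <[lambda]>%VS ->
     forall S : {set 'I_n}, block Gamma S ->
       proj_line <[lambda]>%VS <[eta]>%VS `&`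
         proj_space (Dspace k H Gamma S) !=set0)
  /\
  (forall lambda eta : 'rV[k]_n,
     lambda \in Kspace k H Gamma -> lambda != 0 ->
     eta \in Kspace k H Gamma -> eta != 0 ->
     <[lambda]>%VS <> <[eta]>%VS ->
     (forall S : {set 'I_n}, block Gamma S ->
       proj_line <[lambda]>%VS <[eta]>%VS `&`
         proj_space (Dspace k H Gamma S) !=set0) ->
     proj_line <[lambda]>%VS <[eta]>%VS `<=` Vbar k H Gamma).
Proof.
split=> [lambda eta [lK _] l0 eZ eNl S blS|lambda eta lK l0 eK e0 lNe meets].
  apply/proj_spaceI_neq0; apply: Z_line_meets_D => //.
  exact: maxsetp blS.
have eNl : eta \notin <[lambda]>%VS.
  (* Nested lines of dimension one coincide. *)
  apply/negP; rewrite memvE => sub; apply: lNe; apply/eqP.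
  by rewrite eq_sym eqEdim sub !dim_vline l0 e0.
move=> _ [xi [/= xiL xi0] <-]; exists xi; split=> //; split.
  apply: subvP xiL; by rewrite subv_add -!memvE lK eK.
(* The plane spanned by [lambda] and [eta] lies inside [Zspace H Gamma xi], which gives the
   dimension bound. *)
apply: leq_trans (dim_add_lines _ _ _ _ l0 eNl) (dimvS _).
apply: line_sub_Z => // i j; apply: (@block_meets_edge_minor _ _ _ _ H).
by move=> S /meets/proj_spaceI_neq0.
Qed.
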